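(* Let $p$ be a prime and let $V\subseteq W^{*}$ be the span of the linear functionals $R_{x,y,z}$ for all $x,y,z\in\mathbb{Z}/p\mathbb{Z}$ with $xyz\neq0$, where \[ R_{x,y,z}(f)=f(1:x:y)+f(1:y:z)+f(1:z:x)-f\!\left(1:\tfrac{y}{x}:\tfrac{z}{x}\right). \] Then $V$ equals the annihilator of $W^{\mathrm{nc}}$ in the dual space $W^{*}$ of $W$.
   Context: Let $p$ be a prime. $W$ denotes the complex vector space of functions $f\colon\mathbb{P}^2(\mathbb{Z}/p\mathbb{Z})\to\mathbb{C}$ satisfying (i) $f(x:y:z)=f(z:x:y)=f(-x:y:z)=-f(y:x:z)$ and (ii) $f(x:y:z)+f(-y:x-y:z)+f(y-x:-x:z)=0$ for all points. $W_0$ denotes the complex vector space of functions $f\colon\mathbb{P}^1(\mathbb{Z}/p\mathbb{Z})\to\mathbb{C}$ satisfying (i) $f(x:y)=f(-x:y)=-f(y:x)$, (ii) $f(x:y)+f(-y:x-y)+f(y-x:-x)=0$, (iii) $f(1:0)=0$. For $f\in W_0$ set $f(0:0)=0$, and define linear maps $\alpha,\beta\colon W_0\to W$ by $(\alpha f)(x:y:z)=f(x:y)+f(y:z)+f(z:x)$, and $(\beta f)(x:y:z)=0$ if $xyz\neq0$, $=f(x:y)$ if $z=0$, $=f(y:z)$ if $x=0$, $=f(z:x)$ if $y=0$. Define $W^{\mathrm{nc}}=\alpha(W_0)+\beta(W_0)\subseteq W$. $W^{*}$ denotes the space of $\mathbb{C}$-linear functionals on $W$. *)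

(* Defs.v *)
From HB Require Import structures.
From mathcomp Require Import all_boot all_order all_algebra.
From mathcomp Require Import ring.

Set Implicit Arguments.
Unset Strict Implicit.
Unset Printing Implicit Defensive.

Import GRing.Theory.
Local Open Scope ring_scope.

Section ProjectiveSpace.

Variables (F : finFieldType) (n : nat).

Definition line (v : 'rV[F]_n) : {set 'rV[F]_n} := [set a *: v | a : F].

Definition is_point (L : {set 'rV[F]_n}) :=
  [exists v, (v != 0) && (L == line v)].

(* The points of P(F^n), i.e. of P^(n-1)(F): lines through the origin of F^n. *)
Definition proj := {L : {set 'rV[F]_n} | is_point L}.

Definition rep (P : proj) : 'rV[F]_n :=
  odflt 0 [pick v | (v != 0) && (val P == line v)].

End ProjectiveSpace.

(* The complex functions on P(F^n) are {ffun proj F n -> K^o}, with K the field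
   of scalars.  [ev v f] is the value of f at the class of v; it is 0 if v = 0,
   which provides the convention f (0 : 0) = 0. *)
Definition ev (F : finFieldType) (K : fieldType) n (v : 'rV[F]_n)
    (f : {ffun proj F n -> K^o}) : K^o :=
  if insub (line v) is Some P then f P else 0.

Definition row2 (R : nzRingType) (x y : R) : 'rV[R]_2 :=
  \row_(i < 2) [:: x; y]`_i.
Definition row3 (R : nzRingType) (x y z : R) : 'rV[R]_3 :=
  \row_(i < 3) [:: x; y; z]`_i.

Definition at2 (F : finFieldType) (K : fieldType)
    (f : {ffun proj F 2 -> K^o}) (x y : F) : K^o := ev (row2 x y) f.
Definition at3 (F : finFieldType) (K : fieldType)
    (f : {ffun proj F 3 -> K^o}) (x y z : F) : K^o := ev (row3 x y z) f.

Section ProjectiveSpaceTheory.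

Variables (F : finFieldType) (K : fieldType).

Lemma ev_is_linear n (v : 'rV[F]_n) : linear (@ev F K n v).
Proof.
move=> a f g; rewrite /ev; case: insub => [P|]; first by rewrite !ffunE.
by rewrite scaler0 addr0.
Qed.
HB.instance Definition _ n (v : 'rV[F]_n) :=
  GRing.isLinear.Build K {ffun proj F n -> K^o} K^o *:%R (@ev F K n v)
    (@ev_is_linear n v).

Lemma lineZ n (a : F) (v : 'rV[F]_n) : a != 0 -> line (a *: v) = line v.
Proof.
move=> a0; apply/setP => w; apply/imsetP/imsetP => -[b _ ->].
  by exists (b * a) => //; rewrite scalerA.
by exists (b / a) => //; rewrite scalerA divfK.
Qed.

Lemma line_eqP n (u v : 'rV[F]_n) :
  u != 0 -> line u = line v -> exists2 a, a != 0 & u = a *: v.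
Proof.
move=> u0 E; have : u \in line v.
  by rewrite -E; apply/imsetP; exists 1; rewrite ?scale1r.
case/imsetP => a _ ua; exists a => //.
by apply: contraNneq u0 => a0; rewrite ua a0 scale0r.
Qed.

Lemma line_point n (v : 'rV[F]_n) : v != 0 -> is_point (line v).
Proof. by move=> v0; apply/existsP; exists v; rewrite v0 eqxx. Qed.

Lemma ev0 n (f : {ffun proj F n -> K^o}) : ev 0 f = 0.
Proof.
rewrite /ev; case: insubP => // P /existsP[v /andP[v0 /eqP E]] _.
have [a _ va] := line_eqP v0 (esym E).
by move: v0; rewrite va scaler0 eqxx.
Qed.

Lemma evZ n (a : F) (v : 'rV[F]_n) (f : {ffun proj F n -> K^o}) :
  a != 0 -> ev (a *: v) f = ev v f.
Proof. by move=> a0; rewrite /ev lineZ. Qed.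

Lemma repP n (P : proj F n) : rep P != 0 /\ line (rep P) = val P.
Proof.
rewrite /rep; case: pickP => [v /andP[v0 /eqP E]|] /=; first by [].
by have /existsP[v vP] := valP P => /(_ v); rewrite vP.
Qed.

Lemma ev_rep n (P : proj F n) (f : {ffun proj F n -> K^o}) : ev (rep P) f = f P.
Proof. by rewrite /ev (repP P).2 valK. Qed.

Lemma row2Z (a x y : F) : row2 (a * x) (a * y) = a *: row2 x y.
Proof. by apply/rowP => i; rewrite !mxE; case: i => [[|[|]]]. Qed.

Lemma row3Z (a x y z : F) : row3 (a * x) (a * y) (a * z) = a *: row3 x y z.
Proof. by apply/rowP => i; rewrite !mxE; case: i => [[|[|[|]]]]. Qed.

Lemma row2_eq0 (x y : F) : (row2 x y == 0) = (x == 0) && (y == 0).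
Proof.
apply/eqP/andP => [/rowP E|[/eqP-> /eqP->]].
  by have := (E 0, E 1); rewrite !mxE /= => -[-> ->].
by apply/rowP => i; rewrite !mxE; case: i => [[|[|]]].
Qed.

Lemma row3_eq0 (x y z : F) :
  (row3 x y z == 0) = [&& x == 0, y == 0 & z == 0].
Proof.
apply/eqP/and3P => [/rowP E|[/eqP-> /eqP-> /eqP->]].
  by have := (E 0, E 1, E 2); rewrite !mxE /= => -[[-> ->] ->].
by apply/rowP => i; rewrite !mxE; case: i => [[|[|[|]]]].
Qed.

Lemma row3_eta (v : 'rV[F]_3) : v = row3 (v 0 0) (v 0 1) (v 0 2).
Proof.
apply/rowP => i; rewrite !mxE.
by case: i => [[|[|[|]]]] //= h; congr (v 0 _); apply/val_inj.
Qed.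

Lemma row2_eta (v : 'rV[F]_2) : v = row2 (v 0 0) (v 0 1).
Proof.
apply/rowP => i; rewrite !mxE.
by case: i => [[|[|]]] //= h; congr (v 0 _); apply/val_inj.
Qed.

Lemma at2Z (f : {ffun proj F 2 -> K^o}) a x y :
  a != 0 -> at2 f (a * x) (a * y) = at2 f x y.
Proof. by move=> a0; rewrite /at2 row2Z evZ. Qed.

Lemma at3Z (f : {ffun proj F 3 -> K^o}) a x y z :
  a != 0 -> at3 f (a * x) (a * y) (a * z) = at3 f x y z.
Proof. by move=> a0; rewrite /at3 row3Z evZ. Qed.

Lemma at2_0 (f : {ffun proj F 2 -> K^o}) : at2 f 0 0 = 0.
Proof.
by rewrite /at2 (_ : row2 0 0 = 0) ?ev0 //; apply/eqP; rewrite row2_eq0 eqxx.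
Qed.

(* A function of (x, y, z) invariant under scaling descends to P^2. *)
Lemma at3_descend (h : F -> F -> F -> K^o) :
  (forall a x y z, a != 0 -> h (a * x) (a * y) (a * z) = h x y z) ->
  forall x y z, (x, y, z) != 0 ->
  at3 [ffun P => let v := rep P in h (v 0 0) (v 0 1) (v 0 2)] x y z = h x y z.
Proof.
move=> hZ x y z; rewrite xpair_eqE xpair_eqE -andbA -row3_eq0 => v0.
rewrite /at3 /ev insubT ?line_point // => vP; rewrite ffunE /=.
set P := Sub _ _; have [r0 rE] := repP P.
have [a a0 ->] : exists2 a, a != 0 & rep P = a *: row3 x y z.
  by apply: line_eqP => //; rewrite rE.
by rewrite !mxE /= hZ.
Qed.

End ProjectiveSpaceTheory.

Section Spaces.

Variables (F : finFieldType) (K : fieldType).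

Definition eval2 (x y : F) : 'Hom({ffun proj F 2 -> K^o}, K^o) :=
  linfun (@ev F K 2 (row2 x y)).
Definition eval3 (x y z : F) : 'Hom({ffun proj F 3 -> K^o}, K^o) :=
  linfun (@ev F K 3 (row3 x y z)).

(* The defining equations are imposed as kernels of linear forms; spaceWP and
   spaceW0P give them in terms of the values of f. *)
Definition spaceW : {vspace {ffun proj F 3 -> K^o}} :=
  (\bigcap_(t : F * F * F | t != 0%R) let: (x, y, z) := t in
     lker (eval3 x y z - eval3 z x y)%R
     :&: lker (eval3 x y z - eval3 (- x) y z)%R
     :&: lker (eval3 x y z + eval3 y x z)%R
     :&: lker (eval3 x y z + eval3 (- y) (x - y) z + eval3 (y - x) (- x) z)%R)%VS.

Definition spaceW0 : {vspace {ffun proj F 2 -> K^o}} :=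
  ((\bigcap_(t : F * F | t != 0%R) let: (x, y) := t in
      lker (eval2 x y - eval2 (- x) y)%R :&: lker (eval2 x y + eval2 y x)%R
      :&: lker (eval2 x y + eval2 (- y) (x - y) + eval2 (y - x) (- x))%R)
   :&: lker (eval2 1%R 0%R))%VS.

Lemma spaceWP (f : {ffun proj F 3 -> K^o}) :
  reflect (forall x y z : F, (x, y, z) != 0 ->
    [/\ at3 f x y z = at3 f z x y, at3 f x y z = at3 f (- x) y z,
        at3 f x y z = - at3 f y x z
      & at3 f x y z + at3 f (- y) (x - y) z + at3 f (y - x) (- x) z = 0])
  (f \in spaceW).
Proof.
rewrite memvE /spaceW; apply: (iffP idP) => [/subv_bigcapP H x y z t0 | H].
  have := H (x, y, z) t0; rewrite -memvE !memv_cap !memv_ker.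
  rewrite !add_lfunE !opp_lfunE !(lfunE (ev _)) /= => /andP[/andP[/andP[]]].
  move=> /eqP/subr0_eq h1 /eqP/subr0_eq h2 /eqP/addr0_eq h3 /eqP h4.
  by split=> //; rewrite /at3 -h3 opprK.
apply/subv_bigcapP => -[[x y] z] t0; have [h1 h2 h3 h4] := H x y z t0.
rewrite -memvE !memv_cap !memv_ker !add_lfunE !opp_lfunE !(lfunE (ev _)) /=.
move: h1 h2 h3 h4; rewrite /at3 => <- <- h3 ->.
by rewrite h3 subrr addNr !eqxx.
Qed.

Lemma spaceW0P (f : {ffun proj F 2 -> K^o}) :
  reflect ((forall x y : F, (x, y) != 0 ->
    [/\ at2 f x y = at2 f (- x) y, at2 f x y = - at2 f y x
      & at2 f x y + at2 f (- y) (x - y) + at2 f (y - x) (- x) = 0])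
    /\ at2 f 1 0 = 0)
  (f \in spaceW0).
Proof.
rewrite memv_cap memv_ker (lfunE (ev _)) /= memvE.
apply: (iffP andP) => [[/subv_bigcapP H /eqP f10] | [H f10]].
  split=> // x y t0.
  have := H (x, y) t0; rewrite -memvE !memv_cap !memv_ker.
  rewrite !add_lfunE !opp_lfunE !(lfunE (ev _)) /= => /andP[/andP[]].
  move=> /eqP/subr0_eq h1 /eqP/addr0_eq h2 /eqP h3.
  by split=> //; rewrite /at2 -h2 opprK.
split; last exact/eqP.
apply/subv_bigcapP => -[x y] t0; have [h1 h2 h3] := H x y t0.
rewrite -memvE !memv_cap !memv_ker !add_lfunE !opp_lfunE !(lfunE (ev _)) /=.
move: h1 h2 h3; rewrite /at2 => <- h2 ->.
by rewrite h2 subrr addNr !eqxx.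
Qed.

(* alpha_fun and beta_fun are computed on the representative [rep P]; alphaE and
   betaE show that any representative gives the same value. *)
Definition alpha_fun (f : {ffun proj F 2 -> K^o}) : {ffun proj F 3 -> K^o} :=
  [ffun P => let v := rep P in
    at2 f (v 0 0) (v 0 1) + at2 f (v 0 1) (v 0 2) + at2 f (v 0 2) (v 0 0)].

Definition beta_at (f : {ffun proj F 2 -> K^o}) (x y z : F) : K^o :=
  if x * y * z != 0 then 0
  else if z == 0 then at2 f x y
  else if x == 0 then at2 f y z
  else at2 f z x.

Definition beta_fun (f : {ffun proj F 2 -> K^o}) : {ffun proj F 3 -> K^o} :=
  [ffun P => let v := rep P in beta_at f (v 0 0) (v 0 1) (v 0 2)].

Lemma alpha_funE f x y z : (x, y, z) != 0 ->
  at3 (alpha_fun f) x y z = at2 f x y + at2 f y z + at2 f z x.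
Proof.
apply: (at3_descend (h := fun x y z => at2 f x y + at2 f y z + at2 f z x)).
by move=> a x' y' z' a0; rewrite !at2Z.
Qed.

Lemma beta_funE f x y z : (x, y, z) != 0 ->
  at3 (beta_fun f) x y z = beta_at f x y z.
Proof.
apply: at3_descend => a x' y' z' a0; rewrite /beta_at !at2Z //.
by rewrite !mulf_eq0 (negPf a0).
Qed.

Lemma spaceW0_sym f x y : f \in spaceW0 ->
  [/\ at2 f (- x) y = at2 f x y, at2 f y x = - at2 f x y
    & at2 f x (- y) = at2 f x y].
Proof.
case/spaceW0P => H _.
have [[-> ->]|t0] := eqVneq (x, y) 0; first by rewrite !oppr0 at2_0 oppr0.
have [h1 h2 _] := H x y t0; split; rewrite -?h1 // ?h2 ?opprK //.
have -> : at2 f x (- y) = at2 f (- x) y.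
  have n1 : -1 != 0 :> F by rewrite oppr_eq0 oner_eq0.
  by rewrite -(at2Z f (- x) y n1) !mulN1r opprK.
by rewrite -h1 h2.
Qed.

Lemma spaceW0_rel f x y : f \in spaceW0 ->
  at2 f x y + at2 f (- y) (x - y) + at2 f (y - x) (- x) = 0.
Proof.
case/spaceW0P => H _.
have [[-> ->]|t0] := eqVneq (x, y) 0; last by have [] := H x y t0.
by rewrite subr0 oppr0 at2_0 !addr0.
Qed.

Lemma spaceW0_axis f x : f \in spaceW0 -> at2 f x 0 = 0 /\ at2 f 0 x = 0.
Proof.
move=> fW; have fx : at2 f x 0 = 0.
  have [->|x0] := eqVneq x 0; first exact: at2_0.
  case/spaceW0P: fW => _ <-.
  by rewrite -(at2Z f 1 0 x0) mulr1 mulr0.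
by have [_ -> _] := spaceW0_sym x 0 fW; rewrite fx oppr0.
Qed.

(* The clauses of beta agree where they overlap. *)
Lemma beta_atE f x y z : f \in spaceW0 ->
  [/\ x * y * z != 0 -> beta_at f x y z = 0,
      z = 0 -> beta_at f x y z = at2 f x y,
      x = 0 -> beta_at f x y z = at2 f y z
    & y = 0 -> beta_at f x y z = at2 f z x].
Proof.
move=> fW; rewrite /beta_at; split=> [->//|->|->|->].
- by rewrite mulr0 !eqxx.
- rewrite !mul0r !eqxx /=; case: eqP => // ->.
  by rewrite !(spaceW0_axis _ fW).1 !(spaceW0_axis _ fW).2.
- rewrite mulr0 mul0r !eqxx /=; case: eqP => [->|_].
    by rewrite !(spaceW0_axis _ fW).1 !(spaceW0_axis _ fW).2.
  by case: eqP => // ->; rewrite !(spaceW0_axis _ fW).1 !(spaceW0_axis _ fW).2.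
Qed.

Lemma rot_neq0 (x y z : F) : (x, y, z) != 0 ->
  [/\ (z, x, y) != 0, (- x, y, z) != 0, (y, x, z) != 0,
      (- y, x - y, z) != 0 & (y - x, - x, z) != 0].
Proof.
by move=> t0; split; apply: contraNneq t0 => /eqP;
  rewrite !xpair_eqE ?oppr_eq0 ?subr_eq0 => /andP[/andP[/eqP a /eqP b] /eqP c];
  rewrite ?b ?a ?c ?b ?a ?eqxx.
Qed.

Lemma alpha_mem (f : subvs_of spaceW0) : alpha_fun (vsval f) \in spaceW.
Proof.
have fW := subvsP f; set g := vsval f in fW *.
have gN x y : at2 g (- x) y = at2 g x y by have [] := spaceW0_sym x y fW.
have gN' x y : at2 g x (- y) = at2 g x y by have [] := spaceW0_sym x y fW.
have gC x y : at2 g y x = - at2 g x y by have [] := spaceW0_sym x y fW.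
apply/spaceWP => x y z t0; have [t1 t2 t3 t4 t5] := rot_neq0 t0.
rewrite !alpha_funE //; split.
- by rewrite addrC addrA.
- by rewrite gN gN'.
- by rewrite (gC x y) (gC z x) (gC y z) !opprD !opprK addrAC.
- have := spaceW0_rel x y fW.
  have -> : y - x = - (x - y) by rewrite opprB.
  rewrite !(gN, gN') (gC y z) (gC z x) (gC (x - y) z).
  move: (at2 g _ _) => a; move: (at2 g _ _) => b; move: (at2 g _ _) => c.
  move=> E; rewrite -[RHS]E.
  by ring.
Qed.

Lemma beta_mem (f : subvs_of spaceW0) : beta_fun (vsval f) \in spaceW.
Proof.
have fW := subvsP f; set g := vsval f in fW *.
have gN x y : at2 g (- x) y = at2 g x y by have [] := spaceW0_sym x y fW.
have gN' x y : at2 g x (- y) = at2 g x y by have [] := spaceW0_sym x y fW.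
have gC x y : at2 g y x = - at2 g x y by have [] := spaceW0_sym x y fW.
have g0 x : at2 g x 0 = 0 by case: (spaceW0_axis x fW).
have g0' x : at2 g 0 x = 0 by case: (spaceW0_axis x fW).
apply/spaceWP => x y z t0; have [t1 t2 t3 t4 t5] := rot_neq0 t0.
rewrite !beta_funE //.
have yxE : y - x = - (x - y) by rewrite opprB.
split.
- rewrite /beta_at !mulf_eq0.
  by have [x0|?] := eqVneq x 0; have [y0|?] := eqVneq y 0;
    have [z0|?] := eqVneq z 0; rewrite /= ?x0 ?y0 ?z0 ?g0 ?g0'.
- rewrite /beta_at !mulf_eq0 oppr_eq0.
  by have [x0|?] := eqVneq x 0; have [y0|?] := eqVneq y 0;
    have [z0|?] := eqVneq z 0; rewrite /= ?x0 ?y0 ?z0 ?g0 ?g0' ?gN ?gN'.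
- rewrite /beta_at !mulf_eq0.
  by have [x0|?] := eqVneq x 0; have [y0|?] := eqVneq y 0;
    have [z0|?] := eqVneq z 0; rewrite /= ?x0 ?y0 ?z0 ?g0 ?g0' ?oppr0 //
      gC ?opprK.
have [z0|z0] := eqVneq z 0.
  rewrite /beta_at z0 !mulr0 !eqxx /=; exact: spaceW0_rel.
rewrite /beta_at !mulf_eq0 !oppr_eq0 yxE oppr_eq0 subr_eq0 (negPf z0) !orbF.
have [->|x0] := eqVneq x 0.
  have [->|y0] := eqVneq y 0; first by rewrite /= !(subr0, oppr0, g0', addr0).
  by rewrite /= sub0r opprK addr0 gC addNr.
have [->|y0] := eqVneq y 0.
  by rewrite /= (negPf x0) /= subr0 addr0 gC addNr.
have [->|xy] := eqVneq x y; rewrite /= ?addr0 //.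
by rewrite add0r gC addNr.
Qed.

Definition alpha_map (f : subvs_of spaceW0) : subvs_of spaceW :=
  Subvs (alpha_mem f).
Definition beta_map (f : subvs_of spaceW0) : subvs_of spaceW :=
  Subvs (beta_mem f).

Lemma alpha_map_is_linear : linear alpha_map.
Proof.
move=> a f g; apply: subvs_inj; rewrite [RHS]linearP /=.
apply/ffunP => P; rewrite !ffunE /at2 !linearP /= /GRing.scale /=.
by ring.
Qed.
HB.instance Definition _ := GRing.isLinear.Build K
  (subvs_of spaceW0) (subvs_of spaceW) *:%R alpha_map alpha_map_is_linear.

Lemma beta_map_is_linear : linear beta_map.
Proof.
move=> a f g; apply: subvs_inj; rewrite [RHS]linearP /=.
apply/ffunP => P; rewrite !ffunE /beta_at /at2 !linearP /=.
by do 3?[case: ifP => _]; rewrite ?scaler0 ?addr0.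
Qed.
HB.instance Definition _ := GRing.isLinear.Build K
  (subvs_of spaceW0) (subvs_of spaceW) *:%R beta_map beta_map_is_linear.

Definition alpha : 'Hom(subvs_of spaceW0, subvs_of spaceW) := linfun alpha_map.
Definition beta : 'Hom(subvs_of spaceW0, subvs_of spaceW) := linfun beta_map.

Lemma alphaE f x y z : (x, y, z) != 0 ->
  at3 (vsval (alpha f)) x y z
    = at2 (vsval f) x y + at2 (vsval f) y z + at2 (vsval f) z x.
Proof. by move=> t0; rewrite lfunE /= alpha_funE. Qed.

Lemma betaE f x y z : (x, y, z) != 0 ->
  [/\ x * y * z != 0 -> at3 (vsval (beta f)) x y z = 0,
      z = 0 -> at3 (vsval (beta f)) x y z = at2 (vsval f) x y,
      x = 0 -> at3 (vsval (beta f)) x y z = at2 (vsval f) y z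
    & y = 0 -> at3 (vsval (beta f)) x y z = at2 (vsval f) z x].
Proof.
by move=> t0; rewrite lfunE /= beta_funE //; apply/beta_atE/subvsP.
Qed.

Definition spaceWnc : {vspace subvs_of spaceW} := (limg alpha + limg beta)%VS.

Definition dualW := 'Hom(subvs_of spaceW, K^o).

Definition R_fun (x y z : F) (w : subvs_of spaceW) : K^o :=
  let f := vsval w in
  at3 f 1 x y + at3 f 1 y z + at3 f 1 z x - at3 f 1 (y / x) (z / x).

Lemma R_fun_is_linear x y z : linear (R_fun x y z).
Proof.
move=> a f g; rewrite /R_fun /= /at3 !linearP /=.
by rewrite /GRing.scale /=; ring.
Qed.
HB.instance Definition _ x y z := GRing.isLinear.Build K
  (subvs_of spaceW) K^o *:%R (R_fun x y z) (R_fun_is_linear x y z).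

Definition R_form (x y z : F) : dualW := linfun (R_fun x y z).

Lemma R_formE x y z w : R_form x y z w = R_fun x y z w.
Proof. exact: lfunE. Qed.

Definition spaceV : {vspace dualW} :=
  <<[seq R_form t.1.1 t.1.2 t.2
     | t in [pred t : F * F * F | (t.1.1 * t.1.2 * t.2)%R != 0%R]]>>%VS.

End Spaces.

(* Main.v *)
Require Import Defs.
From mathcomp Require Import all_boot all_order all_algebra.
From mathcomp Require Import reals complex.
From mathcomp Require Import ring.

Import GRing.Theory.
Local Open Scope ring_scope.

(** By duality the claim is that [W^nc] is the common kernel of the [R_{x,y,z}].
    On triples of nonzero scalars, [f] in [W] is a homogeneous 2-cochain of the
    group [F^*], and [R_{x,y,z}(f) = 0] says that it is a cocycle.  Since [#|F^*|]
    is invertible in [K], averaging over the first variable writes [f] there as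
    the coboundary of some [g] in [W_0], i.e. [f - alpha g] vanishes where
    [x y z <> 0]; such a function is [beta] of its restriction to [z = 0]. *)

Lemma memv_bigcap_lker (K : fieldType) (U V : vectType K)
    (s : seq 'Hom(U, V)) (u : U) :
  (u \in \bigcap_(psi <- s) lker psi)%VS = all (fun psi : 'Hom(U, V) => psi u == 0) s.
Proof.
elim: s => [|psi s IHs]; first by rewrite big_nil memvf.
by rewrite big_cons memv_cap memv_ker IHs.
Qed.

Lemma memv_span_lker (K : fieldType) (U : vectType K)
    (s : seq 'Hom(U, K^o)) (phi : 'Hom(U, K^o)) :
  (\bigcap_(psi <- s) lker psi <= lker phi)%VS -> phi \in <<s>>%VS.
Proof.
elim: s phi => [|psi s IHs] phi.
  rewrite big_nil span_nil memv0 => /subvP sub; apply/eqP/lfunP => u.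
  by rewrite lfunE; apply/eqP; rewrite -memv_ker sub ?memvf.
rewrite big_cons span_cons => /subvP sub.
have [/subvP le|/subvPn[u us]] :=
    boolP (\bigcap_(psi0 <- s) lker psi0 <= lker psi)%VS.
  apply/(subvP (addvSr _ _))/IHs/subvP => v vs.
  by apply: sub; rewrite memv_cap le.
rewrite memv_ker => u0; set c := phi u / psi u : K.
rewrite -(subrK (c *: psi) phi) addrC memv_add ?memvZ ?memv_line //.
apply: IHs; apply/subvP => v vs; rewrite memv_ker; set b := psi v / psi u : K.
(* The choice of [b] moves [v] into the kernel of [psi] without leaving the other kernels. *)
have : v - b *: u \in lker phi.
  apply: sub; rewrite memv_cap [in X in _ && X]memvB ?memvZ // andbT memv_ker.
  by rewrite linearB linearZ /= /GRing.scale /= divfK // subrr.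
rewrite memv_ker linearB linearZ /= => /eqP E; apply/eqP; rewrite -[RHS]E.
rewrite add_lfunE opp_lfunE scale_lfunE /GRing.scale /= /b /c; congr (_ - _).
by rewrite mulrAC [RHS]mulrAC (mulrC (phi u)).
Qed.

Section CommonKernel.

Variables (F : finFieldType) (K : fieldType).

Lemma at2_descend (h : F -> F -> K^o) :
  (forall a x y, a != 0 -> h (a * x) (a * y) = h x y) ->
  forall x y, (x, y) != 0 ->
  at2 [ffun P => let v := rep P in h (v 0 0) (v 0 1)] x y = h x y.
Proof.
move=> hZ x y; rewrite xpair_eqE -row2_eq0 => v0.
rewrite /at2 /ev insubT ?line_point // => vP; rewrite ffunE /=.
set P := Sub _ _; have [r0 rE] := repP P.
have [a a0 ->] : exists2 a, a != 0 & rep P = a *: row2 x y.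
  by apply: line_eqP => //; rewrite rE.
by rewrite !mxE /= hZ.
Qed.

Lemma at3_inj (f g : {ffun proj F 3 -> K^o}) :
  (forall x y z, (x, y, z) != 0 -> at3 f x y z = at3 g x y z) -> f = g.
Proof.
move=> fg; apply/ffunP => P; rewrite -2!ev_rep (row3_eta (rep P)).
apply: fg; have [] := repP P.
by rewrite {1}(row3_eta (rep P)) row3_eq0 !xpair_eqE andbA.
Qed.

Lemma at3_0 (f : {ffun proj F 3 -> K^o}) : at3 f 0 0 0 = 0.
Proof.
by rewrite /at3 (_ : row3 0 0 0 = 0) ?ev0 //; apply/eqP; rewrite row3_eq0 eqxx.
Qed.

(** The relations extend to the origin, where [at3 f] is 0, so they can be rewritten with no side
    condition. *)
Lemma spaceW_sym (f : {ffun proj F 3 -> K^o}) : f \in spaceW F K ->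
  [/\ forall x y z, at3 f z x y = at3 f x y z,
      forall x y z, at3 f (- x) y z = at3 f x y z,
      forall x y z, at3 f y x z = - at3 f x y z
    & forall x y z, at3 f x y z + at3 f (- y) (x - y) z
                    + at3 f (y - x) (- x) z = 0].
Proof.
move=> /spaceWP fW.
have H x y z : [/\ at3 f x y z = at3 f z x y, at3 f x y z = at3 f (- x) y z,
    at3 f x y z = - at3 f y x z
    & at3 f x y z + at3 f (- y) (x - y) z + at3 f (y - x) (- x) z = 0].
  have [[-> -> ->]|t0] := eqVneq (x, y, z) 0; last exact: fW.
  by rewrite subr0 oppr0 at3_0 oppr0 !addr0.
by split=> x y z; have [h1 h2 h3 h4] := H x y z => //; rewrite h3 opprK.
Qed.

Lemma eq_opp_eq0 (a : K) : 2 != 0 :> K -> a = - a -> a = 0.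
Proof.
move=> n2 /eqP; rewrite -addr_eq0 -mulr2n -mulr_natl mulf_eq0 (negPf n2).
by move/eqP.
Qed.

(** All four points in [R] have nonzero coordinates, so [beta] contributes nothing. For [alpha g],
    the terms with a coordinate 1 in the first three values cancel by antisymmetry, and scaling the
    last value by [x] matches what remains. *)
Lemma R_fun_spaceWnc (x y z : F) (f : subvs_of (spaceW F K)) :
  x * y * z != 0 -> f \in spaceWnc F K -> R_form K x y z f = 0.
Proof.
rewrite !mulf_eq0 !negb_or -andbA => /and3P[x0 y0 z0].
have n1 (a b : F) : (1 : F, a, b) != 0 by rewrite !xpair_eqE oner_eq0.
case/memv_addP => _ /memv_imgP[g _ ->] [_ /memv_imgP[h _ ->] ->].
rewrite linearD /= !R_formE /R_fun !alphaE //.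
have gC u v : at2 (vsval g) v u = - at2 (vsval g) u v.
  by have [] := spaceW0_sym u v (subvsP g).
have b0 a b : a != 0 -> b != 0 -> at3 (vsval (beta F K h)) 1 a b = 0.
  move=> a0 b0; have [-> //] := betaE h (n1 a b).
  by rewrite mul1r mulf_neq0.
rewrite !b0 ?mulf_neq0 ?invr_eq0 //.
rewrite -(at2Z _ 1 (y / x) x0) -(at2Z _ (y / x) (z / x) x0).
rewrite -(at2Z _ (z / x) 1 x0).
rewrite !(mulrC x) !divfK // mul1r (gC 1 x) (gC 1 y) (gC 1 z).
by ring.
Qed.

(* The cut-off at [x y = 0] is condition (iii) of [W_0]. *)
Definition avg (f : {ffun proj F 3 -> K^o}) (x y : F) : K^o :=
  if x * y == 0 then 0
  else (#|F|.-1)%:R^-1 * \sum_(w : F | w != 0) at3 f w x y.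

Definition avg_fun (f : {ffun proj F 3 -> K^o}) : {ffun proj F 2 -> K^o} :=
  [ffun P => let v := rep P in avg f (v 0 0) (v 0 1)].

Definition restr_fun (f : {ffun proj F 3 -> K^o}) : {ffun proj F 2 -> K^o} :=
  [ffun P => let v := rep P in at3 f (v 0 0) (v 0 1) 0].

Lemma avg_funE f x y : at2 (avg_fun f) x y = avg f x y.
Proof.
have [[-> ->]|xy] := eqVneq (x, y) 0; first by rewrite at2_0 /avg mul0r eqxx.
apply: at2_descend xy => a u v a0.
rewrite /avg !mulf_eq0 (negPf a0) /=; case: ifP => // _; congr (_ * _).
(* The summation variable is scaled along with [u] and [v], so that homogeneity applies termwise. *)
rewrite (reindex_inj (mulfI a0)) /=.
apply: eq_big => [w|w _]; first by rewrite mulf_eq0 (negPf a0).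
exact: at3Z.
Qed.

Lemma restr_funE f x y : at2 (restr_fun f) x y = at3 f x y 0.
Proof.
have [[-> ->]|xy] := eqVneq (x, y) 0; first by rewrite at2_0 at3_0.
move: xy.
apply: (at2_descend (fun x y => at3 f x y 0)) => a u v a0.
by rewrite -{1}(mulr0 a) at3Z.
Qed.

Lemma avg_fun_mem f : 2 != 0 :> K -> f \in spaceW F K ->
  avg_fun f \in spaceW0 F K.
Proof.
move=> n2 /spaceW_sym[fR fN fC fE].
have aC x y : avg f y x = - avg f x y.
  rewrite /avg (mulrC y); case: ifP => _; first by rewrite oppr0.
  rewrite -mulrN -sumrN; congr (_ * _); apply: eq_bigr => w _.
  by rewrite fR fC -(fR x).
have aN x y : avg f (- x) y = avg f x y.
  rewrite /avg mulNr oppr_eq0; case: ifP => // _; congr (_ * _).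
  by apply: eq_bigr => w _; rewrite fR fN -(fR x).
have aN' x y : avg f x (- y) = avg f x y by rewrite aC aN -aC.
have a0 x : avg f x 0 = 0 by rewrite /avg mulr0 eqxx.
have a0' x : avg f 0 x = 0 by rewrite /avg mul0r eqxx.
have axx x : avg f x x = 0 by apply: eq_opp_eq0.
apply/spaceW0P; split=> [x y _|]; rewrite !avg_funE //; split=> //.
(* If [x], [y] or [x - y] is 0, two terms vanish by the cut-off and the third lies on the
   diagonal. *)
have [->|x0] := eqVneq x 0.
  by rewrite sub0r subr0 oppr0 a0 a0' aN aN' axx !addr0.
have [->|y0] := eqVneq y 0.
  by rewrite sub0r subr0 oppr0 a0 a0' aN aN' axx !addr0.
have [->|xy] := eqVneq x y.
  by rewrite axx subrr a0 a0' !addr0.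
rewrite /avg !mulf_eq0 !oppr_eq0 !subr_eq0 (eq_sym y x) (negPf x0) (negPf y0).
rewrite (negPf xy) /= -!mulrDr -!big_split big1 ?mulr0 //= => w _.
(* Cyclic invariance moves [w] to the third place, which the three-term relation leaves fixed. *)
by rewrite -(fR w x y) -(fR w (- y)) -(fR w (y - x)) -!(fR _ w).
Qed.

Lemma restr_fun_mem f : 2 != 0 :> K -> f \in spaceW F K ->
  restr_fun f \in spaceW0 F K.
Proof.
move=> n2 /spaceW_sym[fR fN fC fE].
apply/spaceW0P; split=> [x y _|]; rewrite !restr_funE //.
(* Swapping the first two coordinates fixes [(0 : 0 : 1)], so antisymmetry forces the value 0
   there. *)
by rewrite fR; apply: eq_opp_eq0.
Qed.

(** Homogeneity moves the base point of the cocycle relation from 1 to any [w != 0]; the right-hand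
    side becomes [at3 f x y z], independent of [w], and averaging over [w] gives the claim. *)
Lemma cocycle_avg f : (#|F|.-1)%:R != 0 :> K ->
  (forall x y z : F, x * y * z != 0 ->
     at3 f 1 x y + at3 f 1 y z + at3 f 1 z x = at3 f 1 (y / x) (z / x)) ->
  forall x y z : F, x * y * z != 0 ->
    at3 f x y z = avg f x y + avg f y z + avg f z x.
Proof.
move=> q0 fZ x y z xyz; move: (xyz); rewrite !mulf_eq0 !negb_or -andbA.
case/and3P=> x0 y0 z0.
have fw w : w != 0 -> at3 f w x y + at3 f w y z + at3 f w z x = at3 f x y z.
  move=> w0; have v0 : w^-1 != 0 by rewrite invr_eq0.
  have u0 : w^-1 * x != 0 by rewrite mulf_neq0.
  rewrite -(at3Z f w x y v0) -(at3Z f w y z v0) -(at3Z f w z x v0) mulVf //.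
  rewrite fZ ?mulf_neq0 // -(at3Z f 1 _ _ u0) mulr1 !(mulrC (w^-1 * x)).
  by rewrite !divfK // at3Z.
rewrite /avg !mulf_eq0 (negPf x0) (negPf y0) (negPf z0) /= -!mulrDr.
rewrite -!big_split (eq_bigr _ fw) /= sumr_const.
by rewrite cardC1 -(mulr_natl (at3 f x y z : K)) (mulKf q0).
Qed.

(** Cyclic invariance carries the values on the line [z = 0] to the other two coordinate lines. *)
Lemma beta_restr (h : subvs_of (spaceW F K))
    (hW : restr_fun (vsval h) \in spaceW0 F K) :
  (forall x y z : F, x * y * z != 0 -> at3 (vsval h) x y z = 0) ->
  beta F K (Subvs hW) = h.
Proof.
move=> h0; have [hR _ _ _] := spaceW_sym _ (subvsP h).
apply/subvs_inj/at3_inj => x y z t0; have [bn bz bx bY] := betaE (Subvs hW) t0.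
have hr a b : at2 (vsval (Subvs hW)) a b = at3 (vsval h) a b 0.
  exact: restr_funE.
have [xyz|] := boolP (x * y * z != 0); first by rewrite bn ?h0.
rewrite negbK !mulf_eq0 -orbA => /or3P[] /eqP E.
- by rewrite (bx E) hr E hR.
- by rewrite (bY E) hr E [RHS]hR.
- by rewrite (bz E) hr E.
Qed.

Lemma common_kernel_R (f : subvs_of (spaceW F K)) :
  2 != 0 :> K -> (#|F|.-1)%:R != 0 :> K ->
  (forall x y z : F, x * y * z != 0 -> R_form K x y z f = 0) ->
  f \in spaceWnc F K.
Proof.
move=> n2 q0 fR.
have gW := avg_fun_mem _ n2 (subvsP f).
set h := f - alpha F K (Subvs gW).
have hW := restr_fun_mem _ n2 (subvsP h).
rewrite -(subrK (alpha F K (Subvs gW)) f) -/h addrC -(beta_restr h hW).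
  by apply: memv_add; apply: memv_img; apply: memvf.
move=> x y z xyz; have t0 : (x, y, z) != 0.
  by apply: contraNneq xyz => -[-> _ _]; rewrite !mul0r.
rewrite /h /at3 !linearB /= -!/(at3 _ _ _ _) alphaE //= !avg_funE.
apply/eqP; rewrite subr_eq0; apply/eqP/cocycle_avg => // u v w uvw.
by apply/eqP; rewrite -subr_eq0 -(fR u v w) ?R_formE.
Qed.

Lemma spaceV_annihilator (phi : dualW F K) :
  2 != 0 :> K -> (#|F|.-1)%:R != 0 :> K ->
  phi \in spaceV F K <->
  (forall f : subvs_of (spaceW F K), f \in spaceWnc F K -> phi f = 0).
Proof.
move=> n2 q0; split=> [|phi0].
  rewrite /spaceV => /coord_span -> f fnc; rewrite sum_lfunE big1 // => i _.
  rewrite scale_lfunE; set psi := _`_i.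
  have /imageP[[[x y] z] xyz ->] : psi \in [seq R_form K t.1.1 t.1.2 t.2
      | t in [pred t : F * F * F | t.1.1 * t.1.2 * t.2 != 0]].
    by apply: mem_nth; rewrite size_image.
  by rewrite R_fun_spaceWnc // scaler0.
(* Duality reduces membership in the span to vanishing on the common kernel of the generators, which
   lies in [spaceWnc]. *)
apply/memv_span_lker/subvP => f.
rewrite memv_bigcap_lker memv_ker => /allP fV; apply/eqP/phi0.
apply: common_kernel_R => // x y z xyz; apply/eqP/fV.
by apply/imageP; exists (x, y, z).
Qed.

End CommonKernel.

Theorem theorem3p4 (R : realType) (p : nat) (hp : prime p)
    (phi : dualW 'F_p R[i]) :
  phi \in spaceV 'F_p R[i]
  <-> (forall f : subvs_of (spaceW 'F_p R[i]),
         f \in spaceWnc 'F_p R[i] -> phi f = 0).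
Proof.
(* In characteristic 0 both 2 and [p - 1] are invertible, the latter because [p] is at least 2. *)
by apply: spaceV_annihilator; rewrite Num.Theory.pnatr_eq0 // card_Fp // -lt0n;
  case: p hp {phi} => [|[|]].
Qed.
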